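(* Let $\Delta$ be a finite relational type and let $\mathcal{F}$ be a minimal family of finite connected relational structures of type $\Delta$. Then there exists a class $\mathcal{K}$ of finite lifts of structures of type $\Delta$ by finitely many additional unary relations such that $\mathcal{K}$ is an amalgamation class and the class of shadows $\psi(\mathcal{K})$ equals the class of finite structures in $\mathrm{Forb}_h(\mathcal{F})$, if and only if every minimal cut of every $\mathbf{F}\in\mathcal{F}$ consists of exactly one vertex.
   Context: Structures of type $\Delta=(\delta_i;i\in I)$ are $\mathbf{A}=(A,(R^{\mathbf{A}}_i;i\in I))$, $R^{\mathbf{A}}_i\subseteq A^{\delta_i}$; homomorphisms preserve all relations. $\mathrm{Forb}_h(\mathcal{F})$ is the class of structures admitting no homomorphism from any member of $\mathcal{F}$. A lift of $\mathbf{A}$ is a structure of a larger type $\Delta'\supseteq\Delta$ whose reduct to $\Delta$ (its shadow $\psi$) is $\mathbf{A}$; a monadic lift adds only unary relations. A finite structure $\mathbf{S}$ is a core if every homomorphism $\mathbf{S}\to\mathbf{S}$ is surjective. A finite family $\mathcal{F}$ of finite structures is minimal if all its members are cores and there is no homomorphism between two distinct members of $\mathcal{F}$. An amalgamation class is a class of finite structures closed under isomorphism and induced substructures, with countably many isomorphism types, having the joint embedding property and the amalgamation property (so that it has a Fraïssé limit). The Gaifman graph of $\mathbf{A}$ joins distinct vertices lying in a common tuple; $\mathbf{A}$ is connected if its Gaifman graph is; a cut is a vertex set whose removal disconnects the Gaifman graph, and a minimal cut is an inclusion-minimal cut.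
   Formalization: ''Minimal cut'' is read as a vertex set inclusion-minimal among those separating some fixed pair of vertices, not minimal among all cuts (with that reading the claim fails, e.g. a 4-cycle with pendant edges in eight different relations); relations are taken of positive arity. *)

(* Defs.v *)
From mathcomp Require Import all_boot.

Set Implicit Arguments.
Unset Strict Implicit.
Unset Printing Implicit Defensive.

(* Arities are positive: a nullary relation would take the same value in any
   two structures that embed in a common one. *)
Record rtype := RType {
  symb : finType;
  arity : symb -> nat;
  arity_gt0 : forall i, 0 < arity i }.

(* Finite structures; the empty carrier is allowed. *)
Record finstr (D : rtype) := FinStr {
  carrier :> finType;
  reln : forall i : symb D, {set (arity i).-tuple carrier} }.
Arguments reln {D} A i : rename.

Section Morphisms.
Variable D : rtype.
Implicit Types A B C : finstr D.

Definition hom A B (f : A -> B) : Prop :=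
  forall i (t : (arity i).-tuple A), t \in reln A i -> map_tuple f t \in reln B i.

Definition hom_to A B : Prop := exists f : A -> B, hom f.

Definition embedding A B (f : A -> B) : Prop :=
  injective f /\
  forall i (t : (arity i).-tuple A), (map_tuple f t \in reln B i) = (t \in reln A i).

Definition isomorphic A B : Prop :=
  exists2 f : A -> B, bijective f & embedding f.

Definition core A : Prop :=
  forall f : A -> A, hom f -> forall y, exists x, f x = y.

Definition Forb_h (T : finType) (F : T -> finstr D) A : Prop :=
  forall t, ~ hom_to (F t) A.

Definition minimal_family (T : finType) (F : T -> finstr D) : Prop :=
  (forall t, core (F t)) /\
  (forall s t, s <> t -> ~ hom_to (F s) (F t)).

Definition iso_closed (K : finstr D -> Prop) : Prop :=
  forall A B, isomorphic A B -> K A -> K B.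

Definition hereditary (K : finstr D -> Prop) : Prop :=
  forall A B (f : A -> B), embedding f -> K B -> K A.

Definition countably_many_types (K : finstr D -> Prop) : Prop :=
  exists e : nat -> finstr D, forall A, K A -> exists n, isomorphic (e n) A.

Definition joint_embedding (K : finstr D -> Prop) : Prop :=
  forall A B, K A -> K B ->
  exists C (f : A -> C) (g : B -> C), [/\ K C, embedding f & embedding g].

Definition amalgamation (K : finstr D -> Prop) : Prop :=
  forall A B1 B2 (f1 : A -> B1) (f2 : A -> B2),
  K A -> K B1 -> K B2 -> embedding f1 -> embedding f2 ->
  exists C (g1 : B1 -> C) (g2 : B2 -> C),
    [/\ K C, embedding g1, embedding g2 & forall x, g1 (f1 x) = g2 (f2 x)].

Definition amalgamation_class (K : finstr D -> Prop) : Prop :=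
  [/\ iso_closed K, hereditary K, countably_many_types K,
      joint_embedding K & amalgamation K].

Definition gaifman A : rel A := fun x y =>
  (x != y) && [exists i, exists t in reln A i, (x \in t) && (y \in t)].

Definition connected A : Prop :=
  0 < #|A| /\ forall x y : A, connect (gaifman (A := A)) x y.

(* The Gaifman graph is restricted to the complement of C; this is not the
   Gaifman graph of the substructure induced on that complement, since tuples
   meeting C still join their remaining vertices. *)
Definition separates A (x y : A) (C : {set A}) : bool :=
  [&& x \notin C, y \notin C &
      ~~ connect [rel u v | [&& gaifman u v, u \notin C & v \notin C]] x y].

Definition cut A (C : {set A}) : Prop := exists x y, separates x y C.

(* Inclusion-minimality is taken among the cuts separating the same two
   vertices: C is a minimal separator, i.e. the common neighbourhood of two
   components of its complement. A set minimal among all cuts is a special case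
   (minimal_cutW), but quantifying over those only is not enough: in a 4-cycle
   with a pendant edge at every vertex they are the four cut vertices and miss
   the two separating pairs of the cycle. If the eight edges carry eight
   different relations, this structure has no monadic amalgamation class. *)
Definition minimal_cut A (C : {set A}) : Prop :=
  exists x y : A, minset (separates x y) C.

Lemma minimal_cut_cut A (C : {set A}) : minimal_cut C -> cut C.
Proof. by move=> [x [y /minsetP [sC _]]]; exists x, y. Qed.

Lemma minimal_cutW A (C : {set A}) :
  cut C -> (forall B : {set A}, cut B -> B \subset C -> B = C) -> minimal_cut C.
Proof.
move=> [x [y sC]] minC; exists x, y; apply/minsetP; split=> // B sB.
by apply: minC; exists x, y.
Qed.

End Morphisms.

Section Lifts.
Variables (D : rtype) (J : finType).

Definition lift_arity (s : symb D + J) : nat :=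
  match s with inl i => arity i | inr _ => 1 end.

Lemma lift_arity_gt0 s : 0 < lift_arity s.
Proof. by case: s => //= i; apply: arity_gt0. Qed.

Definition monadic_lift : rtype := RType lift_arity_gt0.

Definition shadow (B : finstr monadic_lift) : finstr D :=
  @FinStr D B (fun i => reln B (inl i)).

End Lifts.

(* Main.v *)
(* Sufficiency. If minimal cuts are singletons, any two non-adjacent vertices of
   F are separated by a single vertex, so F is a tree of cliques. A branch of F
   at c is a set of vertices attached to the rest of F through c only. Lift A by
   recording, for each branch, the vertices v such that the branch together with
   its root c maps to A with c sent to v. When two structures whose lifts agree
   on a common part are freely amalgamated, no vertex gains a branch: the clique
   of F at c maps into one side, and by induction so do the smaller branches
   hanging from it. Hence the amalgam still omits F, and the substructures of
   the lifts amalgamate.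

   Necessity. Let C be a minimal separator of x and y in F with two vertices
   c <> c', and let L be the component of x in F - C together with C. Take
   copies of C indexed by i in I, glue a copy of L on each of them, and for
   i <> j glue a copy of the rest of F on C with c taken at index i and the other
   vertices at index j. A homomorphism from F would, F being a core, be a section
   of the projection to F, and the connected sides of x and y would force i = j;
   so the result omits F. If I is large, two indices i <> j carry the same unary
   relations in a lift; amalgamating the copy of L at (i, i) with the copy of the
   rest at (j, i) over C then produces F. *)
Require Import Defs.
From mathcomp Require Import all_boot.

Set Implicit Arguments.
Unset Strict Implicit.
Unset Printing Implicit Defensive.

Lemma connect_closed (V : finType) (e : rel V) (P : {set V}) x y :
  (forall u v, u \in P -> e u v -> v \in P) -> x \in P -> connect e x y -> y \in P.
Proof.
move=> clP + /connectP[p + ->]; elim: p x => //= z p IHp x Px /andP[exz].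
by apply: IHp; apply: clP exz.
Qed.

Section Gaifman.
Variables (D : rtype) (A : finstr D).
Implicit Types x y : A.

Lemma gaifman_sym : symmetric (gaifman (A := A)).
Proof.
move=> x y; rewrite /gaifman eq_sym; congr (_ && _).
by apply: eq_existsb => i; apply: eq_existsb => t; rewrite [_ && (y \in _)]andbC.
Qed.

Lemma gaifmanP x y :
  reflect (x != y /\ exists i, exists2 t : (arity i).-tuple A,
             t \in reln A i & (x \in t) && (y \in t)) (gaifman x y).
Proof.
apply: (iffP andP) => -[nxy].
  by case/existsP=> i /existsP[t /andP[tR txy]]; split=> //; exists i, t.
case=> i [t tR txy]; split=> //; apply/existsP; exists i.
by apply/existsP; exists t; rewrite tR.
Qed.

Lemma gaifman_tuple i (t : (arity i).-tuple A) x y :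
  t \in reln A i -> x \in t -> y \in t -> x != y -> gaifman x y.
Proof. by move=> tR xt yt nxy; apply/gaifmanP; split=> //; exists i, t; rewrite ?xt. Qed.

End Gaifman.

Section Separators.
Variables (D : rtype) (G : finstr D).
Implicit Types (x y u v z : G) (C : {set G}).

Definition off_rel C : rel G :=
  [rel u v | [&& gaifman u v, u \notin C & v \notin C]].

Lemma connect_off C x z : x \notin C -> connect (off_rel C) x z -> z \notin C.
Proof.
move=> xC cxz; rewrite -in_setC; apply: connect_closed cxz; last by rewrite inE.
by move=> u v _ /and3P[_ _]; rewrite in_setC.
Qed.

Lemma connect_off_sym C : symmetric (connect (off_rel C)).
Proof.
apply: sym_connect_sym => u v; rewrite /off_rel /= gaifman_sym.
by congr (_ && _); apply: andbC.
Qed.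

Lemma separatesC x y C : separates x y C = separates y x C.
Proof. by rewrite /separates andbCA [connect _ x y]connect_off_sym. Qed.

Lemma min_separator_nbr x y C d : minset (separates x y) C -> d \in C ->
  exists2 u, connect (off_rel C) x u & gaifman u d.
Proof.
move=> /minsetP[sC minC] dC; have /and3P[xC yC ncxy] := sC.
have [/existsP[u /andP[cu ud]]|/existsPn nod] :=
  boolP [exists u, connect (off_rel C) x u && gaifman u d]; first by exists u.
suff CD : C :\ d = C by rewrite -CD !inE eqxx in dC.
apply: minC; last exact: subsetDl.
apply/and3P; split.
- by rewrite !inE (negPf xC) andbF.
- by rewrite !inE (negPf yC) andbF.
apply: contra ncxy => cxy.
suff : y \in [set z | connect (off_rel C) x z] by rewrite inE.
apply: (connect_closed _ _ cxy); last by rewrite inE connect0.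
move=> u v; rewrite !inE => cu /and3P[uv _]; rewrite !inE negb_and negbK => vC.
apply: (connect_trans cu); apply: connect1; apply/and3P; split=> //.
  exact: connect_off cu.
by case/orP: vC => // /eqP vd; have := nod u; rewrite cu -vd uv.
Qed.

End Separators.

Section Branches.
Variables (D : rtype) (A : finstr D).
Implicit Types (c d x y z : A) (K M : {set A}).

Lemma connected_closed (P : {set A}) x y : connected A ->
  (forall u v, u \in P -> gaifman u v -> v \in P) -> x \in P -> y \in P.
Proof. by move=> [_ cA] clP Px; apply: connect_closed clP Px (cA x y). Qed.

Definition branch c K :=
  (c \notin K) && [forall u in K, forall v, gaifman u v ==> (v \in c |: K)].

Lemma branchP c K :
  reflect (c \notin K /\ forall u v, u \in K -> gaifman u v -> v \in c |: K)
          (branch c K).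
Proof.
apply: (iffP andP) => -[cK].
  by move=> /forall_inP h; split=> // u v uK; move/forallP: (h u uK) => /(_ v)/implyP.
by move=> h; split=> //; apply/forall_inP=> u uK; apply/forallP=> v; apply/implyP/h.
Qed.

Lemma branch_notin c K : branch c K -> c \notin K.
Proof. by case/branchP. Qed.

Lemma branch_nbr c K u v : branch c K -> u \in K -> gaifman u v -> v \in c |: K.
Proof. by case/branchP=> _; apply. Qed.

Lemma branch_tuple c K i (t : (arity i).-tuple A) z :
  branch c K -> t \in reln A i -> z \in t -> z \in K -> {subset t <= c |: K}.
Proof.
move=> brK tR zt zK u ut; have [<-|nzu] := eqVneq z u; first by rewrite setU1r.
exact: branch_nbr brK zK (gaifman_tuple tR zt ut nzu).
Qed.

Lemma branch_setC1 c : branch c [set~ c].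
Proof.
apply/branchP; split=> [|u v _ _]; first by rewrite !inE eqxx.
by rewrite !inE orbN.
Qed.

Lemma branchI c d K M : branch c K -> branch d M -> c \notin d |: M ->
  branch d (M :&: K).
Proof.
move=> brK brM cM; apply/branchP; split=> [|u v].
  by rewrite inE (negPf (branch_notin brM)).
case/setIP=> uM uK uv; have := branch_nbr brK uK uv; have := branch_nbr brM uM uv.
rewrite !inE => /predU1P[->|vM /predU1P[vc|vK]]; first by rewrite eqxx.
  by case/negP: cM; rewrite -vc !inE vM orbT.
by rewrite vM vK orbT.
Qed.

Definition separable := forall x y, x != y -> ~~ gaifman x y ->
  exists d M, [/\ branch d M, x \in M & y \notin d |: M].

Lemma minimal_cuts_separable :
  (forall C : {set A}, minimal_cut C -> #|C| = 1) -> separable.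
Proof.
move=> cut1 x y nxy nadj.
have sxy : separates x y (~: [set x; y]).
  apply/and3P; split; [by rewrite !inE eqxx | by rewrite !inE eqxx orbT |].
  apply: contra nxy => cxy.
  have /set1P-> // : y \in [set x]; apply: connect_closed (set11 x) cxy => u v.
  move=> /set1P-> /and3P[xv _]; rewrite in_setC negbK => /set2P[->|vy].
    exact: set11.
  by move: xv; rewrite vy => /(negP nadj).
have [C minC _] := minset_exists (P := separates x y) sxy.
have /cards1P[d Cd] : #|C| == 1 by apply/eqP/cut1; exists x, y.
have /and3P[xC yC ncxy] := minsetp minC.
have notC := connect_off xC.
exists d, [set z | connect (off_rel C) x z]; split.
- apply/branchP; split=> [|u v]; rewrite !inE.
    by apply/negP=> /notC; rewrite Cd inE eqxx.
  move=> cu uv; have [//|nvd] := eqVneq v d; apply: (connect_trans cu).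
  by apply: connect1; apply/and3P; split; [exact: uv | exact: notC | rewrite Cd inE].
- by rewrite inE connect0.
by rewrite !inE negb_or -in_set1 -Cd yC.
Qed.

Hypotheses (connA : connected A) (sepA : separable).

(* Take the largest set M containing z and hanging from a single vertex q other
   than c; if q were not adjacent to c, a vertex separating q from c would give
   a larger one. *)
Lemma branch_nbr_cover c K z : branch c K -> z \in K -> ~~ gaifman c z ->
  exists q, [/\ q \in K, gaifman c q &
    exists2 M, branch q M & [/\ z \in M, c \notin M & M \subset K]].
Proof.
move=> brK zK ncz.
have cz : c != z by apply: contra (branch_notin brK) => /eqP->.
pose P := fun M => [&& z \in M, M \subset K & [exists d, (d != c) && branch d M]].
have [M0 PM0] : exists M, P M.
  have [||d [M [brM zM cM]]] := sepA (x := z) (y := c); rewrite 1?eq_sym //.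
    by rewrite gaifman_sym.
  exists (M :&: K); rewrite /P inE zM zK subsetIr /=; apply/existsP; exists d.
  rewrite (branchI brK brM cM) andbT; apply: contra cM => /eqP->.
  by rewrite !inE eqxx.
have [M /maxsetP[/and3P[zM MK /existsP[d /andP[dc brM]]] maxM] _] := maxset_exists PM0.
have cM : c \notin M by apply: contra (branch_notin brK); apply: (subsetP MK).
have dK : d \in K.
  apply: contraR cM => dK; apply: connected_closed connA _ zM => u v uM uv.
  have := branch_nbr brM uM uv; rewrite !inE => /predU1P[vd|//].
  have := branch_nbr brK (subsetP MK u uM) uv.
  by rewrite vd !inE (negPf dK) (negPf dc).
exists d; split=> //; last by exists M.
apply: contraR cM => ncd.
have [||d' [M' [brM' dM' cM']]] := sepA (x := d) (y := c) => //.
  by rewrite gaifman_sym.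
have brN := branchI brK brM' cM'; set N := M' :&: K in brN.
have dN : d \in N by rewrite inE dM' dK.
have cN : c \notin N by rewrite inE (negPf (branch_notin brK)) andbF.
have d'c : d' != c by apply: contra cM' => /eqP->; rewrite !inE eqxx.
have [d'M|d'M] := boolP (d' \in M).
  suff : c \in M :|: N by rewrite inE (negPf cN) orbF.
  have zMN : z \in M :|: N by rewrite inE zM.
  apply: connected_closed connA _ zMN => u v; rewrite !in_setU => /orP[uM|uN] uv.
    by have /setU1P[->|->] := branch_nbr brM uM uv; rewrite ?dN ?orbT.
  by have /setU1P[->|->] := branch_nbr brN uN uv; rewrite ?d'M ?orbT.
case/negP: (branch_notin brM); rewrite -(maxM (M :|: N)).
- by rewrite inE dN orbT.
- rewrite /P in_setU zM subUset MK subsetIr /=; apply/existsP; exists d'; rewrite d'c /=.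
  apply/branchP; split=> [|u v]; first by rewrite inE negb_or d'M branch_notin.
  rewrite !in_setU => /orP[uM|uN] uv.
    by have /setU1P[->|->] := branch_nbr brM uM uv; rewrite ?dN ?orbT.
  by have /setU1P[->|->] := branch_nbr brN uN uv; rewrite ?inE ?eqxx ?orbT.
exact: subsetUl.
Qed.
End Branches.

Lemma eq_in_map_tuple (A B : eqType) n (f g : A -> B) (t : n.-tuple A) :
  {in t, f =1 g} -> map_tuple f t = map_tuple g t.
Proof. by move=> fg; apply/val_inj/eq_in_map. Qed.

Lemma map_tuple_comp (A B C : Type) n (f : B -> C) (g : A -> B) (t : n.-tuple A) :
  map_tuple f (map_tuple g t) = map_tuple (f \o g) t.
Proof. by apply: val_inj; rewrite /= map_comp. Qed.

Lemma map_tuple_cancel (A B : eqType) n (f : A -> B) (g : B -> A) (t : n.-tuple A) :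
  cancel f g -> map_tuple g (map_tuple f t) = t.
Proof. by move=> fK; apply/val_inj/mapK. Qed.

Lemma map_tuple1 (A B : Type) (f : A -> B) (t : 1.-tuple A) :
  map_tuple f t = [tuple f (thead t)].
Proof. by case/tupleP: t => x t; rewrite tuple0 theadE; apply: val_inj. Qed.

Section RootedHom.
Variables (D : rtype) (G : finstr D).
Implicit Types (A B : finstr D) (c : G) (K S : {set G}).

Definition partial_hom A S (g : G -> A) : Prop :=
  forall i (t : (arity i).-tuple G), t \in reln G i -> {subset t <= S} ->
    map_tuple g t \in reln A i.

Definition rooted_hom A c K (v : A) : Prop :=
  exists2 g : G -> A, g c = v & partial_hom (c |: K) g.

Lemma partial_homS A S S' (g : G -> A) :
  S \subset S' -> partial_hom S' g -> partial_hom S g.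
Proof. by move=> /subsetP sSS' pg i t tR tS; apply: pg tR _ => x /tS/sSS'. Qed.

Lemma hom_comp_partial A B S (g : G -> A) (h : A -> B) :
  hom h -> partial_hom S g -> partial_hom S (h \o g).
Proof. by move=> hh pg i t tR tS; rewrite -map_tuple_comp; apply/hh/pg. Qed.

Lemma hom_rooted A B (h : A -> B) c K v :
  hom h -> rooted_hom c K v -> rooted_hom c K (h v).
Proof. by move=> hh [g <- pg]; exists (h \o g) => //; apply: hom_comp_partial. Qed.

Definition rooted_homb A c K (v : A) : bool :=
  [exists g : {ffun G -> A}, (g c == v) &&
    [forall i, forall t in reln G i,
      all (mem (c |: K)) t ==> (map_tuple g t \in reln A i)]].

Lemma rooted_homP A c K (v : A) : reflect (rooted_hom c K v) (rooted_homb c K v).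
Proof.
apply: (iffP existsP) => [[g /andP[/eqP gc pg]]|[g gc pg]].
  exists g => // i t tR tS; move/forallP/(_ i)/forall_inP/(_ t tR)/implyP: pg.
  by apply; apply/allP.
exists (finfun g); rewrite ffunE gc eqxx; apply/forallP=> i; apply/forall_inP=> t tR.
apply/implyP=> /allP tS; rewrite (_ : map_tuple _ t = map_tuple g t) ?pg //.
by apply: eq_in_map_tuple => x _; rewrite ffunE.
Qed.

Hypotheses (connG : connected G) (sepG : separable G).

(* C is an amalgam of B true and B false in which no tuple mixes the two sides. *)
Variables (B : bool -> finstr D) (C : finstr D) (h : forall b, B b -> C).
Hypothesis emb : forall b, embedding (@h b).
Hypothesis relC : forall i (t : (arity i).-tuple C), t \in reln C i ->
  exists b, {subset t <= codom (@h b)}.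
Hypothesis compat : forall b b' v w, h (b := b) v = h (b := b') w ->
  forall c K, branch c K -> rooted_hom c K v -> rooted_hom c K w.

Let in_amalgam c K (f : G -> C) :=
  forall b v, f c = h (b := b) v -> rooted_hom c K v.

Lemma amalgam_mixed c K (f : G -> C) x y b : branch c K ->
    (forall (d : G) (M : {set G}) (g : G -> C), #|M| < #|K| ->
      branch d M -> partial_hom (d |: M) g -> in_amalgam d M g) ->
    partial_hom (c |: K) f -> x \in K -> y \in K ->
    gaifman c x -> gaifman c y ->
    x != y -> ~~ gaifman x y -> forall v, f c = h (b := b) v -> rooted_hom c K v.
Proof.
move=> brK IH pf xK yK cx cy nxy ngxy v fc.
have [d [M [brM xM yM]]] := sepG nxy ngxy.
have /setU1P[dc|cM] : c \in d |: M.
- by apply: branch_nbr brM xM _; rewrite gaifman_sym.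
- rewrite -{d}dc in brM yM; have cM := branch_notin brM.
  have cK := branch_notin brK.
  have yNM : y \notin M by apply: contra yM; apply: setU1r.
  have br1 : branch c (K :&: M).
    apply/branchP; rewrite inE (negPf cK); split=> // u w /setIP[uK uM] uw.
    have := branch_nbr brK uK uw; have := branch_nbr brM uM uw.
    by rewrite !inE; case: (w == c) => //= -> ->.
  have br2 : branch c (K :\: M).
    apply/branchP; rewrite !inE (negPf cK) andbF; split=> // u w /setDP[uK uM] uw.
    have := branch_nbr brK uK uw; rewrite !inE; have [//|nwc /= ->] := eqVneq w c.
    rewrite andbT; apply: contra uM => wM.
    have := @branch_nbr _ _ _ _ w u brM wM; rewrite gaifman_sym => /(_ uw).
    by case/setU1P=> // uc; rewrite uc (negPf cK) in uK.
  have sub (K' : {set G}) : K' \subset K -> partial_hom (c |: K') f.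
    by move=> sK; apply: partial_homS pf; apply: setUS.
  have lt1 : #|K :&: M| < #|K|.
    apply/proper_card/properP; split; first exact: subsetIl.
    by exists y; rewrite // inE yK.
  have lt2 : #|K :\: M| < #|K|.
    apply/proper_card/properP; split; first exact: subsetDl.
    by exists x; rewrite // inE xM.
  have [g1 g1c pg1] := IH _ _ _ lt1 br1 (sub _ (subsetIl _ _)) _ _ fc.
  have [g2 g2c pg2] := IH _ _ _ lt2 br2 (sub _ (subsetDl _ _)) _ _ fc.
  exists (fun z => if z \in M then g1 z else g2 z); first by rewrite (negPf cM).
  move=> i t tR tS.
  have [/hasP[z zt zM]|/hasPn tM] := boolP (has (mem M) t).
    have tM := branch_tuple brM tR zt zM.
    rewrite (@eq_in_map_tuple _ _ _ _ g1) => [|u ut].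
      apply: pg1 tR _ => u ut; have := tS u ut; have := tM u ut.
      by rewrite !inE; case: (u == c) => //= -> ->.
    by have /setU1P[->|->//] := tM u ut; rewrite (negPf cM) g1c.
  rewrite (@eq_in_map_tuple _ _ _ _ g2) => [|u /tM/negPf/= ->] //.
  apply: pg2 tR _ => u ut; have := tS u ut; rewrite !inE.
  by case: (u == c) => //= ->; rewrite andbT; apply: tM.
by case/negP: yM; apply: branch_nbr brM cM cy.
Qed.

Lemma amalgam_pure c K (f : G -> C) b : branch c K ->
    (forall (d : G) (M : {set G}) (g : G -> C), #|M| < #|K| ->
      branch d M -> partial_hom (d |: M) g -> in_amalgam d M g) ->
    partial_hom (c |: K) f ->
    (forall x, x \in K -> gaifman c x -> f x \in codom (@h b)) ->
    forall v, f c = h (b := b) v -> rooted_hom c K v.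
Proof.
move=> brK IH pf fN v fc.
have [inj_h emb_h] := emb b; have cK := branch_notin brK.
pose N := [set q in K | gaifman c q].
have fN' z : exists w, z \in c |: N -> h (b := b) w = f z.
  have [/setU1P[->|]|_] := boolP (z \in c |: N); [by exists v | | by exists v].
  by rewrite inE => /andP[zK cz]; have /codomP[w ->] := fN z zK cz; exists w.
have [f0 f0P] := fin_all_exists fN'.
have f0c : f0 c = v by apply: inj_h; rewrite f0P ?setU11.
(* The part of K hanging from the neighbour q of c; by separability, K is the
   disjoint union of N and these parts. *)
pose Kq q := \bigcup_(M | [&& branch q M, c \notin M & M \subset K]) M.
have cKq q : c \notin Kq q by apply/bigcupP=> -[M /and3P[_ /negP cM _]].
have KqK q : Kq q \subset K by apply/bigcupsP=> M /and3P[].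
have brKq q : branch q (Kq q).
  apply/branchP; split=> [|u w /bigcupP[M brM uM] uw].
    by apply/bigcupP=> -[M /and3P[/branch_notin/negP]].
  have /and3P[br _ _] := brM; have /setU1P[->|wM] := branch_nbr br uM uw.
    exact: setU11.
  by apply/setU1r/bigcupP; exists M.
have qKq q q' : q \in N -> q' \in N -> q \notin Kq q'.
  rewrite !inE => /andP[_ cq] /andP[q'K _]; apply/negP=> qKq'.
  rewrite gaifman_sym in cq; case/setU1P: (branch_nbr (brKq q') qKq' cq) => [cq'|].
    by rewrite cq' q'K in cK.
  by rewrite (negPf (cKq q')).
have uniqKq q q' z : q \in N -> q' \in N -> z \in Kq q -> z \in Kq q' -> q = q'.
  move=> qN q'N zq zq'; apply: contraNeq (cKq q) => nqq'.
  suff /setIP[] : c \in Kq q :&: Kq q' by [].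
  have zI : z \in Kq q :&: Kq q' by rewrite inE zq.
  apply: connected_closed connG _ zI => u w /setIP[uq uq'] uw.
  have := branch_nbr (brKq q') uq' uw; have := branch_nbr (brKq q) uq uw.
  case/setU1P=> [->|wq] /setU1P[wq'|wq'].
  - by rewrite wq' eqxx in nqq'.
  - by case/negP: (qKq q q' qN q'N).
  - by case/negP: (qKq q' q q'N qN); rewrite -wq'.
  by rewrite inE wq.
have gP q : exists g : G -> B b,
    q \in N -> g q = f0 q /\ partial_hom (q |: Kq q) g.
  have [qN|_] := boolP (q \in N); last by exists f0.
  have [qK cq] : q \in K /\ gaifman c q by move: qN; rewrite inE => /andP[].
  have ltq : #|Kq q| < #|K|.
    by apply/proper_card/properP; split=> //; exists q; rewrite ?(branch_notin (brKq q)).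
  have pfq : partial_hom (q |: Kq q) f.
    apply: partial_homS pf; rewrite subUset sub1set setU1r //=.
    exact: subset_trans (KqK q) (subsetUr _ _).
  have fq : f q = h (f0 q) by rewrite f0P // setU1r.
  by have [g gq pg] := IH _ _ _ ltq (brKq q) pfq _ _ fq; exists g.
have [G' G'P] := fin_all_exists gP.
pose g z := if [pick q in N | z \in Kq q] is Some q then G' q z else f0 z.
have g_in q z : q \in N -> z \in Kq q -> g z = G' q z.
  rewrite /g => qN zq; case: pickP => [q' /andP[q'N zq']|/(_ q)].
    by rewrite (uniqKq q' q z).
  by rewrite qN zq.
have g_out z : (forall q, q \in N -> z \notin Kq q) -> g z = f0 z.
  by rewrite /g => zN; case: pickP => // q /andP[/zN/negPf->].
exists g; first by rewrite g_out // => q _.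
move=> i t tR tS.
have [/existsP[q /andP[qN /hasP[z zt zq]]]|/existsPn tN] :=
  boolP [exists q, (q \in N) && has (mem (Kq q)) t].
  have tq := branch_tuple (brKq q) tR zt zq; have [g'q pg'] := G'P q qN.
  rewrite (@eq_in_map_tuple _ _ _ _ (G' q)) => [|u ut]; first exact: pg'.
  have /setU1P[->|uq] := tq u ut; last exact: g_in.
  by rewrite g_out ?g'q // => q' q'N; apply: qKq.
have tN' u q : u \in t -> q \in N -> u \notin Kq q.
  by move=> ut qN; have := tN q; rewrite qN => /hasPn; apply.
rewrite (@eq_in_map_tuple _ _ _ _ f0) => [|u ut]; last first.
  by apply: g_out => q qN; apply: tN'.
rewrite -emb_h map_tuple_comp (@eq_in_map_tuple _ _ _ _ f) => [|u ut]; first exact: pf.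
apply: f0P; have /setU1P[->|uK] := tS u ut; first exact: setU11.
apply: setU1r; rewrite inE uK /=; apply: contraT => ncu.
have [q [qK cq [M brM [uM cM MK]]]] := branch_nbr_cover connG sepG brK uK ncu.
have qN : q \in N by rewrite inE qK.
by case/negP: (tN' u q ut qN); apply/bigcupP; exists M => //; apply/and3P.
Qed.

Lemma amalgam_rooted c K (f : G -> C) : branch c K -> partial_hom (c |: K) f ->
  in_amalgam c K f.
Proof.
have [n] := ubnP #|K|; elim: n => // n IHn in c K f * => /ltnSE leKn brK pf b v fc.
have IH (d : G) (M : {set G}) (g : G -> C) : #|M| < #|K| ->
    branch d M -> partial_hom (d |: M) g -> in_amalgam d M g.
  by move=> ltMK; apply: IHn; apply: leq_trans leKn.
pose pure b := [forall x in K, gaifman c x ==> (f x \in codom (@h b))].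
have pureP b' : pure b' -> forall x, x \in K -> gaifman c x -> f x \in codom (@h b').
  by move=> /forall_inP p x xK; apply/implyP/p.
have [/pureP pb|] := boolP (pure b); first exact: amalgam_pure pb _ fc.
case/forall_inPn=> x xK; rewrite negb_imply => /andP[cx fx].
have same y z : y \in K -> gaifman y z ->
    exists b', f y \in codom (@h b') /\ f z \in codom (@h b').
  move=> yK /gaifmanP[_ [i [t tR /andP[yt zt]]]].
  have [b' tb'] := relC (pf i t tR (branch_tuple brK tR yt yK)).
  by exists b'; split; apply/tb'/map_f.
have [b' [fxb' fcb']] : exists b', f x \in codom (@h b') /\ f c \in codom (@h b').
  by apply: same => //; rewrite gaifman_sym.
have bb' : b' != b by apply: contraNneq fx => <-.
have [/pureP pb'|] := boolP (pure b').
  have /codomP[w fcw] := fcb'.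
  by apply: (compat (v := w)) => //; [rewrite -fcw | exact: amalgam_pure pb' _ fcw].
case/forall_inPn=> y yK; rewrite negb_imply => /andP[cy fy].
apply: (amalgam_mixed brK IH pf xK yK) fc => //.
  by apply: contraNneq fy => <-.
apply/negP=> /(same _ _ xK)[b3 [fx3 fy3]].
have [b3b|b3b] := eqVneq b3 b; first by rewrite -b3b fx3 in fx.
have b3b' : b3 = b' by case: (b3) (b) (b') bb' b3b => -[] [].
by rewrite -b3b' fy3 in fy.
Qed.
End RootedHom.

Section Embeddings.
Variable D : rtype.
Implicit Types A B C : finstr D.

Lemma embedding_comp A B C (f : A -> B) (g : B -> C) :
  embedding f -> embedding g -> embedding (g \o f).
Proof.
move=> [inj_f ef] [inj_g eg]; split; first exact: inj_comp.
by move=> i t; rewrite -map_tuple_comp eg ef.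
Qed.

Lemma embedding_id A : embedding (@id A).
Proof. by split=> // i t; rewrite (_ : map_tuple id t = t) //; apply/val_inj/map_id. Qed.

Lemma embedding_hom A B (f : A -> B) : embedding f -> hom f.
Proof. by move=> [_ ef] i t; rewrite ef. Qed.

Lemma isomorphic_inv A B : isomorphic A B -> exists g : B -> A, embedding g.
Proof.
move=> [f [g fK gK] [_ ef]]; exists g; split; first exact: can_inj gK.
move=> i t; rewrite -ef map_tuple_comp (_ : map_tuple _ t = t) //.
by apply/val_inj => /=; apply: map_id_in => x _; apply: gK.
Qed.

Lemma all_countable (K : finstr D -> Prop) : countably_many_types K.
Proof.
pose rel n (s : seq (symb D * seq nat)) (i : symb D) : {set (arity i).-tuple 'I_n} :=
  [set t : (arity i).-tuple 'I_n | (i, map val t) \in s].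
exists (fun k => if @unpickle (nat * seq (symb D * seq nat))%type k is Some ns
                 then FinStr (rel ns.1 ns.2) else FinStr (rel 0 [::])) => A _.
pose U := {i : symb D & (arity i).-tuple 'I_#|A|}.
pose s := [seq (tag u, map val (tagged u)) | u : U in
             [pred u : U | map_tuple (@enum_val _ A) (tagged u) \in reln A (tag u)]].
exists (pickle (#|A|, s)); rewrite pickleK /=.
exists (@enum_val _ A : 'I_#|A| -> A).
  by apply: (Bijective (@enum_valK _) (@enum_rankK _)).
split=> [|i t]; first exact: enum_val_inj.
rewrite inE; apply/idP/imageP => [tR|[[j t'] /= t'R [eq_ij]]].
  by exists (Tagged (fun i : symb D => (arity i).-tuple 'I_#|A|) t).
by case: j / eq_ij t' t'R => t' t'R /(inj_map val_inj)/val_inj->.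
Qed.

Lemma joint_embedding_of_amalgamation (K : finstr D -> Prop) :
  hereditary K -> amalgamation K -> joint_embedding K.
Proof.
move=> hK aK A B KA KB.
pose E := @FinStr D void (fun i => set0).
have emb (X : finstr D) : embedding (of_void X : E -> X).
  by split=> [[]|i t]; have [] := thead (tcast (esym (prednK (arity_gt0 i))) t).
have [C [f [g [KC ef eg _]]]] := aK E A B _ _ (hK _ _ _ (emb A) KA) KA KB (emb A) (emb B).
by exists C, f, g.
Qed.

Lemma free_amalgam A (X : bool -> finstr D) (a : forall b, A -> X b) :
    (forall b, embedding (a b)) ->
  exists C (h : forall b, X b -> C),
    [/\ forall b, embedding (@h b), forall v, exists b x, v = h b x,
        forall i (t : (arity i).-tuple C), t \in reln C i ->
          exists b, {subset t <= codom (@h b)},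
        forall z, h true (a true z) = h false (a false z) &
        forall b b' x y, h b x = h b' y -> b != b' ->
          exists z, x = a b z /\ y = a b' z].
Proof.
move=> emb_a; have inj_a b := (emb_a b).1.
pose h0 b : X b -> X true + X false :=
  match b with
  | true => inl
  | false => fun y =>
      if [pick z | a false z == y] is Some z then inl (a true z) else inr y
  end.
have h0a z : h0 false (a false z) = inl (a true z).
  rewrite /=; case: pickP => [z' /eqP/inj_a->//|/(_ z)]; by rewrite eqxx.
have h0_mixed x y : h0 true x = h0 false y ->
    exists z, x = a true z /\ y = a false z.
  by rewrite /=; case: pickP => // z /eqP <- [->]; exists z.
have inj_h0 b : injective (h0 b).
  case: b => x y; first by case.
  rewrite /=; case: pickP => [z /eqP<-|_]; case: pickP => [z' /eqP<-|_] //.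
    by case=> /inj_a->.
  by case.
have glue b b' x y : h0 b x = h0 b' y -> b != b' -> exists z, x = a b z /\ y = a b' z.
  case: b b' x y => -[] // x y; first by move/h0_mixed.
  by move/esym/h0_mixed => -[z []]; exists z.
pose W := {w : X true + X false | [exists b, w \in codom (h0 b)]}.
have hP b (x : X b) : [exists b', h0 b x \in codom (h0 b')].
  by apply/existsP; exists b; apply: codom_f.
pose h b (x : X b) : W := exist _ (h0 b x) (hP b x).
have h_h0 b b' (x : X b) (y : X b') : h b x = h b' y -> h0 b x = h0 b' y.
  by move/(congr1 val).
have inj_h b : injective (h b) by move=> x y /h_h0/inj_h0.
pose C := @FinStr D W (fun i => \bigcup_b [set map_tuple (h b) t | t in reln (X b) i]).
exists C, h; split.
- move=> b; split=> // i t; apply/bigcupP/idP => [[b' _ /imsetP[t' t'R tt']]|tR].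
    have [bb'|nbb'] := eqVneq b b'.
      case: b' / bb' t' t'R tt' => t' t'R /(congr1 val)/= /(inj_map (@inj_h b)) tt'.
      by rewrite (val_inj tt').
    have tn (k : 'I_(arity i)) : exists z, tnth t k = a b z /\ tnth t' k = a b' z.
      apply: glue nbb'; apply: h_h0.
      by have := congr1 (fun s => tnth s k) tt'; rewrite !tnth_map.
    have [s sP] := fin_all_exists tn.
    have ts : t = map_tuple (a b) [tuple s k | k < arity i].
      by apply: eq_from_tnth => k; rewrite tnth_map tnth_mktuple; case: (sP k).
    have ts' : t' = map_tuple (a b') [tuple s k | k < arity i].
      by apply: eq_from_tnth => k; rewrite tnth_map tnth_mktuple; case: (sP k).
    by rewrite ts (emb_a b).2 -(emb_a b').2 -ts'.
  by exists b => //; apply: imset_f.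
- move=> [w wP]; have /existsP[b /codomP[x wx]] := wP.
  by exists b, x; apply: val_inj.
- move=> i t /bigcupP[b _ /imsetP[t' _ ->]]; exists b => x /mapP[y _ ->].
  exact: codom_f.
- by move=> z; apply: val_inj; rewrite [RHS]h0a.
by move=> b b' x y /h_h0; apply: glue.
Qed.

End Embeddings.

Section CanonicalLift.
Variables (D : rtype) (T : finType) (F : T -> finstr D).

Definition rooted_index : finType := {t : T & (F t * {set F t})%type}.

Definition canonical_lift (A : finstr D) : finstr (monadic_lift D rooted_index) :=
  @FinStr (monadic_lift D rooted_index) A
    (fun s => match s return {set (lift_arity s).-tuple A} with
      | inl i => reln A i
      | inr j => let c := (tagged j).1 in let K := (tagged j).2 in
          [set v | branch c K && rooted_homb c K (thead v)]
      end).

Definition lift_class (B : finstr (monadic_lift D rooted_index)) : Prop :=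
  exists A (e : B -> canonical_lift A), Forb_h F A /\ embedding e.

Lemma shadow_embedding J (A B : finstr (monadic_lift D J)) (f : A -> B) :
  embedding f -> @embedding D (shadow A) (shadow B) f.
Proof. by move=> [inj_f ef]; split=> // i; apply: (ef (inl i)). Qed.

Lemma Forb_hS (A B : finstr D) : hom_to A B -> Forb_h F B -> Forb_h F A.
Proof.
move=> [f hf] FB t [g hg]; apply: (FB t); exists (f \o g) => i s sR.
by rewrite -map_tuple_comp; apply/hf/hg.
Qed.

Lemma canonical_liftE (A B : finstr D) (f : A -> B) :
    embedding f ->
    (forall t (c : F t) K v, branch c K -> rooted_hom c K (f v) -> rooted_hom c K v) ->
  @embedding _ (canonical_lift A) (canonical_lift B) f.
Proof.
move=> ef fU; split=> [|[i|[t [c K]]] v]; [exact: ef.1 | exact: ef.2 |].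
rewrite map_tuple1 !inE theadE /=; apply: andb_id2l => brK.
apply/rooted_homP/rooted_homP => [/(fU _ _ _ _ brK)//|].
by apply/hom_rooted/embedding_hom.
Qed.

Lemma lift_class_shadow (A : finstr D) :
  (exists2 B, lift_class B & shadow B = A) <-> Forb_h F A.
Proof.
split=> [[B [A' [e [FA' /shadow_embedding/embedding_hom he]]] <-]|FA].
  by apply: Forb_hS FA'; exists e.
exists (canonical_lift A); last by case: A {FA}.
by exists A, id; split=> //; apply: embedding_id.
Qed.

Hypotheses (Fconn : forall t, connected (F t)) (Fsep : forall t, separable (F t)).

Lemma lift_class_amalgamation : amalgamation lift_class.
Proof.
move=> A B1 B2 f1 f2 KA [X1 [e1 [FX1 emb1]]] [X2 [e2 [FX2 emb2]]] ef1 ef2.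
pose X b := if b then X1 else X2.
pose a b : A -> X b := match b with true => e1 \o f1 | false => e2 \o f2 end.
have emb_a b : @embedding _ A (canonical_lift (X b)) (a b).
  by case: b; apply: embedding_comp.
have FX b : Forb_h F (X b) by case: b.
have [C [h [emb_h cover relC ha glue]]] :=
  free_amalgam (fun b =>
    shadow_embedding (emb_a b) : @embedding D (shadow A) (X b) (a b)).
have compat t b b' (v : X b) (w : X b') : h b v = h b' w -> forall (c : F t) K,
    branch c K -> rooted_hom c K v -> rooted_hom c K w.
  move=> vw c K brK Uv; have [bb'|nbb'] := eqVneq b b'.
    by case: b' / bb' w vw => w /(emb_h b).1 <-.
  have [z [vz wz]] := glue _ _ _ _ vw nbb'.
  pose j : rooted_index := Tagged (fun t => (F t * {set F t})%type) (c, K).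
  have inj b1 : ([tuple z] \in reln A (inr j)) = rooted_homb c K (a b1 z).
    by have := (emb_a b1).2 (inr j) [tuple z]; rewrite map_tuple1 inE theadE /= brK.
  by apply/rooted_homP; rewrite wz -inj (inj b) -vz; apply/rooted_homP.
have amalg t := amalgam_rooted (Fconn t) (@Fsep t) emb_h relC (@compat t).
have FC : Forb_h F C.
  move=> t [f hf]; have /card_gt0P[c _] := (Fconn t).1.
  have [b [v fc]] := cover (f c).
  have pf : partial_hom (c |: [set~ c]) f by move=> i s sR _; apply: hf.
  have [g _ pg] := amalg t c _ f (branch_setC1 c) pf b v fc.
  apply: (FX b t); exists g => i s sR; apply: pg => // x _.
  by rewrite setUCr in_setT.
have emb_lift b : @embedding _ (canonical_lift (X b)) (canonical_lift C) (h b).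
  apply: canonical_liftE => // t c K v brK [f fc pf]; exact: amalg brK pf _ _ fc.
exists (canonical_lift C), (h true \o e1), (h false \o e2); split.
- by exists C, id; split=> //; apply: embedding_id.
- exact: embedding_comp emb1 (emb_lift true).
- exact: embedding_comp emb2 (emb_lift false).
exact: ha.
Qed.

Lemma lift_class_amalgamation_class : amalgamation_class lift_class.
Proof.
have hK : hereditary lift_class.
  move=> A B f ef [X [e [FX ee]]]; exists X, (e \o f).
  by split=> //; apply: embedding_comp ee.
split=> //.
- by move=> A B /isomorphic_inv[g eg]; apply: hK eg.
- exact: all_countable.
- exact: joint_embedding_of_amalgamation hK lift_class_amalgamation.
exact: lift_class_amalgamation.
Qed.

End CanonicalLift.


Lemma core_section (D : rtype) (G X : finstr D) (f : G -> X) (p : X -> G) :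
  core G -> hom f -> hom p -> exists2 s : G -> X, hom s & forall v, p (s v) = v.
Proof.
move=> coreG hf hp; pose phi := p \o f.
have hphi : hom phi by move=> i t tR; rewrite -map_tuple_comp; apply/hp/hf.
have surj := coreG _ hphi.
have [psi psiK] := fin_all_exists surj; have phiK := canF_sym psiK.
exists (f \o psi) => // i t tR; rewrite -map_tuple_comp; apply: hf.
have inj_map_phi : injective (map_tuple phi : (arity i).-tuple G -> _).
  by move=> t1 t2 /(congr1 val)/(inj_map (can_inj phiK))/val_inj.
have imR : [set map_tuple phi t | t in reln G i] = reln G i.
  apply/eqP; rewrite eqEcard card_imset // leqnn andbT.
  by apply/subsetP=> _ /imsetP[t' t'R ->]; apply: hphi.
move: tR; rewrite -{1}imR => /imsetP[t' t'R ->].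
by rewrite map_tuple_cancel.
Qed.

Section TwistedCopies.
Variables (D : rtype) (G : finstr D) (I : finType).
Variables (x y c c' : G) (C : {set G}).
Hypotheses (minC : minset (separates x y) C) (cC : c \in C) (cC' : c' \in C).
Hypothesis cc' : c' != c.

Let e := off_rel C.
Let Kx := [set z | connect e x z].

(* Only some of the triples are used; the other elements are isolated. *)
Definition left_copy (i : I) (v : G) : G * I * I := (v, i, i).

Definition right_copy (i j : I) (v : G) : G * I * I :=
  if v \in C then left_copy (if v == c then i else j) v else (v, i, j).

Definition twisted : finstr D := @FinStr D (G * I * I)%type (fun k =>
  [set s | [exists t in reln G k,
     [exists i, all (mem (Kx :|: C)) t && (s == map_tuple (left_copy i) t)] ||
     [exists i, exists j, [&& i != j, all (mem (~: Kx)) t &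
        s == map_tuple (right_copy i j) t]]]]).

Definition twisted_proj (w : twisted) : G := w.1.1.

Lemma right_copyK i j : cancel (right_copy i j) twisted_proj.
Proof. by move=> v; rewrite /right_copy; case: ifP. Qed.

Lemma twistedP k (s : (arity k).-tuple twisted) : s \in reln twisted k ->
  exists2 t, t \in reln G k &
    (exists2 i, {subset t <= Kx :|: C} & s = map_tuple (left_copy i) t) \/
    (exists i j, [/\ i != j, {subset t <= ~: Kx} & s = map_tuple (right_copy i j) t]).
Proof.
rewrite inE => /exists_inP[t tR /orP[/existsP[i /andP[/allP tL /eqP->]]|]].
  by exists t => //; left; exists i.
case/existsP=> i /existsP[j /and3P[ij /allP tK /eqP->]].
by exists t => //; right; exists i, j.
Qed.

Lemma left_copy_hom i : @partial_hom D G twisted (Kx :|: C) (left_copy i).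
Proof.
move=> k t tR tL; rewrite inE; apply/exists_inP; exists t => //.
by apply/orP; left; apply/existsP; exists i; rewrite eqxx andbT; apply/allP.
Qed.

Lemma right_copy_hom i j : i != j -> @partial_hom D G twisted (~: Kx) (right_copy i j).
Proof.
move=> ij k t tR tK; rewrite inE; apply/exists_inP; exists t => //.
apply/orP; right; apply/existsP; exists i; apply/existsP; exists j.
by rewrite ij eqxx andbT; apply/allP.
Qed.

Lemma twisted_proj_hom : hom twisted_proj.
Proof.
move=> k s /twistedP[t tR [[i _ ->]|[i [j [_ _ ->]]]]]; rewrite map_tuple_cancel //.
exact: right_copyK.
Qed.

Lemma twisted_no_section (s : G -> twisted) :
  hom s -> ~ (forall v, twisted_proj (s v) = v).
Proof.
move=> hs sK; have /minsetP[/and3P[xC yC ncxy] _] := minC.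
have adj u v : gaifman u v ->
    (exists i, [/\ u \in Kx :|: C, s u = left_copy i u & s v = left_copy i v]) \/
    (exists i j, [/\ i != j, u \notin Kx,
       s u = right_copy i j u & s v = right_copy i j v]).
  move=> /gaifmanP[_ [k [t tR /andP[ut vt]]]].
  have eq_t t' f : cancel f twisted_proj -> map_tuple s t = map_tuple f t' ->
      t' = t /\ {in t, s =1 f}.
    move=> fK eq_st.
    have tt' : t' = t by rewrite -(map_tuple_cancel t' fK) -eq_st map_tuple_cancel.
    split=> // w wt; rewrite tt' in eq_st.
    by have /eq_in_map := congr1 val eq_st; apply.
  have [t' _ [[i tL /eq_t[]//]|[i [j [ij tK /eq_t[]]]]]] := twistedP (hs k t tR).
    by move=> tt' st; left; exists i; rewrite !st //; split=> //; apply: tL; rewrite tt'.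
  - exact: right_copyK.
  move=> tt' st; right; exists i, j; rewrite !st //; split=> //.
  by rewrite -in_setC; apply: tK; rewrite tt'.
have Kx_const u : connect e x u -> (s u).2 = (s x).2.
  move=> cxu; suff : u \in [set v in Kx | (s v).2 == (s x).2].
    by rewrite inE => /andP[_ /eqP].
  apply: connect_closed cxu; last by rewrite !inE connect0 eqxx.
  move=> v w; rewrite !inE => /andP[cv /eqP <-] vw.
  rewrite (connect_trans cv (connect1 vw)) /=; have /and3P[gvw _ _] := vw.
  have [[i [_ -> ->]]//|[i [j [_]]]] := adj v w gvw.
  by rewrite inE cv.
have C_left d : d \in C -> s d = left_copy (s x).2 d.
  move=> dC; have [u cu ud] := min_separator_nbr minC dC; rewrite -(Kx_const u cu).
  have [[i [_ -> ->]]//|[i [j [_]]]] := adj u d ud.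
  by rewrite inE cu.
have offK u : connect e y u -> u \notin C /\ u \notin Kx.
  move=> cu; split; first exact: connect_off cu.
  rewrite inE; apply: contra ncxy => cxu; apply: (connect_trans cxu).
  by rewrite connect_off_sym.
have adjy u v : connect e y u -> gaifman u v -> exists i j,
    [/\ i != j, s u = (u, i, j) & s v = right_copy i j v].
  move=> /offK[uC uK] /adj[[i []]|[i [j [ij _ su sv]]]].
    by rewrite in_setU (negPf uC) (negPf uK).
  by exists i, j; rewrite su sv /right_copy (negPf uC).
have Ky_const u : connect e y u -> ((s u).1.2, (s u).2) = ((s y).1.2, (s y).2).
  move=> cyu.
  suff : u \in [set v | connect e y v & ((s v).1.2, (s v).2) == ((s y).1.2, (s y).2)].
    by rewrite inE => /andP[_ /eqP].
  apply: connect_closed cyu; last by rewrite !inE connect0 eqxx.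
  move=> v w; rewrite !inE => /andP[cv /eqP <-] vw.
  have cw := connect_trans cv (connect1 vw); rewrite cw /=; have /and3P[gvw _ _] := vw.
  have [i [j [_ -> ->]]] := adjy v w cv gvw.
  by rewrite /right_copy (negPf (offK w cw).1).
have minC' : minset (separates y x) C.
  by rewrite (minset_eq (P2 := separates x y)) // => B; apply: separatesC.
have C_right d : d \in C -> (s y).1.2 != (s y).2 /\ s d = right_copy (s y).1.2 (s y).2 d.
  move=> dC; have [u cu ud] := min_separator_nbr minC' dC.
  have [<- <-] := Ky_const u cu; have [i [j [ij -> ->]]] := adjy u d cu ud; by [].
have [nij] := C_right c cC; rewrite C_left // /right_copy cC eqxx => -[eq_i].
have [_] := C_right c' cC'; rewrite C_left // /right_copy cC' (negPf cc') => -[eq_j].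
by rewrite -eq_i -eq_j eqxx in nij.
Qed.

End TwistedCopies.

Section Necessity.
Variables (D : rtype) (T : finType) (F : T -> finstr D).
Hypotheses (Fmin : minimal_family F) (Fconn : forall t, connected (F t)).

Lemma twisted_Forb (I : finType) t (x y c c' : F t) (C : {set F t}) :
    minset (separates x y) C -> c \in C -> c' \in C -> c' != c ->
  Forb_h F (twisted I x c C).
Proof.
move=> minC cC cC' cc' t' [f hf]; have hp := @twisted_proj_hom _ _ I x c C.
have [tt'|/eqP nt't] := eqVneq t' t; last first.
  apply: (Fmin.2 t' t nt't); exists (twisted_proj (C := C) \o f) => i s sR.
  by rewrite -map_tuple_comp; apply/hp/hf.
subst t'; have [s hs sK] := core_section (Fmin.1 t) hf hp.
exact: twisted_no_section minC cC cC' cc' s hs sK.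
Qed.

Lemma monadic_lift_cut (J : finType) (K : finstr (monadic_lift D J) -> Prop)
    t (x y c c' : F t) (C : {set F t}) :
    hereditary K -> amalgamation K ->
    (forall A, (exists2 B, K B & shadow B = A) <-> Forb_h F A) ->
    minset (separates x y) C -> c \in C -> c' \in C -> c' = c.
Proof.
move=> hK aK shK minC cC cC'; apply: contraTeq isT => cc'; exfalso.
set G := F t in x y c c' C minC cC cC' cc'.
pose I : finType := option {set G * J}.
set X := twisted I x c C.
have [B KB BX] := (shK X).2 (twisted_Forb (I := I) minC cC cC' cc').
pose Kx := [set z | connect (off_rel C) x z].
have [l [r [p [hp lK rK lr [hl hr]]]]] : exists (l : I -> G -> shadow B)
    (r : I -> I -> G -> shadow B) (p : shadow B -> G),
    [/\ hom p, forall i, cancel (l i) p, forall i j, cancel (r i j) p,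
        forall i j v, v \in C -> r i j v = l (if v == c then i else j) v &
        (forall i, partial_hom (Kx :|: C) (l i)) /\
        (forall i j, i != j -> partial_hom (~: Kx) (r i j))].
  rewrite BX; exists (@left_copy _ _ _), (@right_copy _ _ _ c C).
  exists (@twisted_proj _ _ _ x c C).
  split=> //; first exact: twisted_proj_hom.
  - exact: right_copyK.
  - by move=> i j v vC; rewrite /right_copy vC.
  by split; [exact: left_copy_hom | exact: right_copy_hom].
pose col i := [set vj : G * J | [tuple l i vj.1] \in reln B (inr vj.2)].
have /injectivePn[i [j nij eq_col]] : ~~ injectiveb col.
  apply/negP=> /injectiveP/leq_card.
  by rewrite card_option ltnn.
have copy_rel f k (u : (arity k).-tuple G) : cancel f p ->
    (u \in reln G k -> map_tuple f u \in reln (shadow B) k) ->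
    (map_tuple f u \in reln B (inl k)) = (u \in reln G k).
  move=> fK fR; apply/idP/idP => // /(hp k : forall t, t \in reln B (inl k) -> _).
  by rewrite map_tuple_cancel.
pose S : finType := {v : G | v \in C}.
pose f1 (v : S) : B := l i (val v).
pose f2 (v : S) : B := r j i (val v).
have f2l v : f2 v = l (if val v == c then j else i) (val v) by apply/lr/valP.
pose A := @FinStr (monadic_lift D J) S (fun s => [set u | map_tuple f1 u \in reln B s]).
have CK v : v \in C -> v \notin Kx.
  have /and3P[xC _ _] := minsetp minC.
  by apply: contraTN; rewrite inE; apply: connect_off xC.
have subC k (u : k.-tuple S) v : v \in map_tuple val u -> v \in C.
  by case/mapP=> w _ ->; apply: valP.
have ef1 : @embedding _ A B f1.
  by split=> [v w /(can_inj (lK i))/val_inj//|s u]; rewrite inE.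
have ef2 : @embedding _ A B f2.
  split=> [v w /(can_inj (rK j i))/val_inj//|[k|vj] u]; rewrite inE.
    have R1 : map_tuple (l i) (map_tuple val u) \in reln B (inl k)
        = (map_tuple val u \in reln G k).
      by apply: copy_rel => // uR; apply: hl => // v /subC vC; rewrite in_setU vC orbT.
    have R2 : map_tuple (r j i) (map_tuple val u) \in reln B (inl k)
        = (map_tuple val u \in reln G k).
      apply: copy_rel => // uR; apply: hr => // [|v /subC/CK]; first by rewrite eq_sym.
      by rewrite in_setC.
    rewrite map_tuple_comp in R1; rewrite map_tuple_comp in R2.
    exact: etrans R2 (esym R1).
  rewrite !map_tuple1 f2l; case: ifP => // _.
  by have /setP/(_ (val (thead u), vj)) := eq_col; rewrite !inE.
have [E [g1 [g2 [KE eg1 eg2 g12]]]] :=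
  aK A B B f1 f2 (hK _ _ _ ef1 KB) KB KB ef1 ef2.
have : Forb_h F (shadow E) by apply/shK; exists E.
move/(_ t); apply; exists (fun v => if v \in Kx then g1 (l i v) else g2 (r j i v)).
move=> k u uR; rewrite -/G in u uR *.
have [/hasP[z zu zK]|/hasPn uK] := boolP (has (mem Kx) u).
  have uL : {subset u <= Kx :|: C}.
    move=> v vu; rewrite in_setU orbC; have [//|vC] := boolP (v \in C).
    have [<-//|zv] := eqVneq z v; move: (zK); rewrite !inE => cz.
    apply: (connect_trans cz); apply: connect1; apply/and3P; split=> //.
      exact: gaifman_tuple uR zu vu zv.
    by apply: contraTN zK; apply: CK.
  rewrite (@eq_in_map_tuple _ _ _ _ (g1 \o l i)) => [|v vu].
    by rewrite -map_tuple_comp (eg1.2 (inl k)); apply: hl.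
  case: ifP => // vK; have := uL v vu; rewrite in_setU vK /= => vC.
  by have := g12 (Sub v vC); rewrite /f1 /f2 SubK.
rewrite (@eq_in_map_tuple _ _ _ _ (g2 \o r j i)) => [|v /uK/negPf/= ->] //.
rewrite -map_tuple_comp (eg2.2 (inl k)); apply: hr => [|//|v vu]; first by rewrite eq_sym.
by rewrite in_setC; apply: uK.
Qed.

End Necessity.

Theorem theorem5 (D : rtype) (T : finType) (F : T -> finstr D)
    (Fmin : minimal_family F) (Fconn : forall t : T, connected (F t)) :
  (exists (J : finType) (K : finstr (monadic_lift D J) -> Prop),
      amalgamation_class K /\
      forall A : finstr D, (exists2 B, K B & shadow B = A) <-> Forb_h F A)
  <->
  (forall (t : T) (C : {set F t}), minimal_cut C -> #|C| = 1).
Proof.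
split=> [[J [K [[_ hK _ _ aK] shK]]] t C [x [y minC]]|cut1].
  have [C0|[c cC]] := set_0Vmem C.
    have /and3P[_ _ /negP[]] := minsetp minC.
    suff : y \in [set z | connect (off_rel C) x z] by rewrite inE.
    have : x \in [set z | connect (off_rel C) x z] by rewrite inE connect0.
    apply: connected_closed (Fconn t) _ => u v; rewrite !inE => cu uv.
    by apply: (connect_trans cu); apply: connect1; rewrite /off_rel /= uv C0 !inE.
  apply/eqP/cards1P; exists c; apply/setP=> c'; rewrite inE.
  apply/idP/eqP => [cC'|->//].
  exact: monadic_lift_cut hK aK shK minC cC cC'.
exists (rooted_index F), (@lift_class D T F); split.
  by apply: lift_class_amalgamation_class => // t; apply/minimal_cuts_separable/cut1.
exact: lift_class_shadow.
Qed.
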